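(* Let $W=W^1\cup W^2\cup W^3\cup W^4$ be a disjoint union of finite sets, let $W^4_I\subseteq W^4$ and $W_I=W^1\cup W^2\cup W^4_I$. Let $m_1,m_2\ge 0$ be integers and let $$P=\{(x,y,z,\omega)\in\mathbb{R}^{W^1}\times\mathbb{R}^{W^2}\times\mathbb{R}^{W^3}\times\mathbb{R}^{W^4} : Ax+By+Cz=b,\ Dx+Ey+F\omega=g,\ \ell\le(x,y,z,\omega)\le u\},$$ where $A\in\mathbb{Z}^{m_1\times W^1}$, $B\in\mathbb{Z}^{m_1\times W^2}$, $C\in\mathbb{Z}^{m_1\times W^3}$, $b\in\mathbb{Z}^{m_1}$, $D\in\mathbb{Q}^{m_2\times W^1}$, $E\in\mathbb{Q}^{m_2\times W^2}$, $F\in\mathbb{Q}^{m_2\times W^4}$, $g\in\mathbb{Q}^{m_2}$, and $\ell\le u$ are rational vectors (possibly with infinite entries $-\infty$ in $\ell$ and $+\infty$ in $u$). Suppose that for some $k\le|W^2|$ there exist matrices $S\in\mathbb{Z}^{m_1\times W^2}$, $U\in\mathbb{Z}^{m_1\times k}$, $T\in\mathbb{Z}^{k\times W^2}$ and $R\in\mathbb{Q}^{m_2\times k}$ such that $B=S+UT$, $E=RT$, the matrix $\begin{bmatrix} S & C \\ T & 0 \end{bmatrix}$ is totally unimodular, and $\ell,u\in\mathbb{M}^{W_I\cup W^3}$. Then for any $d=(d_{W^1},d_T,d_{W^4_I})\in\mathbb{Z}^{W^1}\times\mathbb{Z}^k\times\mathbb{Z}^{W^4_I}$, the affine fiber $H_d:=\{(x,y,z,\omega)\in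 P : x=d_{W^1},\ Ty=d_T,\ \omega_{W^4_I}=d_{W^4_I}\}$ satisfies $$H_d=\mathrm{conv}(H_d\cap\mathbb{M}^{W_I})=\mathrm{conv}(H_d\cap\mathbb{M}^{W_I\cup W^3}),$$ and $$\mathrm{conv}(P\cap\mathbb{M}^{W_I})=\mathrm{conv}(P\cap\mathbb{M}^{W_I\cup W^3})=\mathrm{conv}(\{(x,y,z,\omega)\in P : x\in\mathbb{Z}^{W^1},\ Ty\in\mathbb{Z}^k,\ \omega\in\mathbb{M}^{W^4_I}\}).$$
   Context: For an index set $S$ of some of the variables, $\mathbb{M}^{S}$ denotes the set of vectors (on the relevant full variable index set) whose coordinates indexed by $S$ are integers; in the condition $\ell,u\in\mathbb{M}^{W_I\cup W^3}$, infinite entries are considered integral. A matrix is totally unimodular if every nonsingular square submatrix has determinant $\pm1$. *)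

(* Defs.v *)
From HB Require Import structures.
From mathcomp Require Export all_boot all_order all_algebra.
From mathcomp Require Export all_classical all_reals.
From mathcomp Require Export convex.

Set Implicit Arguments.
Unset Strict Implicit.
Unset Printing Implicit Defensive.

Import Order.TTheory GRing.Theory Num.Theory.

Local Open Scope classical_set_scope.
Local Open Scope ring_scope.

Definition convex_hull (R : realType) (V : lmodType R) (X : set V) : set V :=
  smallest (@convex_set R V) X.

(* A submatrix is a choice of distinct rows and distinct columns; the order in
   which they are listed only affects the sign of the determinant. *)
Definition totally_unimodular (m n : nat) (M : 'M[int]_(m, n)) : Prop :=
  forall (p : nat) (f : 'I_p -> 'I_m) (g : 'I_p -> 'I_n),
    injective f -> injective g ->
    \det (mxsub f g M) != 0 ->
    \det (mxsub f g M) = 1 \/ \det (mxsub f g M) = -1.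

Section Variables.
Variables W1 W2 W3 W4 : finType.

Definition var : finType := (W1 + W2 + W3 + W4)%type.

Definition in1 (i : W1) : var := inl (inl (inl i)).
Definition in2 (i : W2) : var := inl (inl (inr i)).
Definition in3 (i : W3) : var := inl (inr i).
Definition in4 (i : W4) : var := inr i.

Definition W3_vars : {set var} := [set in3 i | i : W3]%SET.

Definition W4I_vars (W4I : {set W4}) : {set var} := [set in4 i | i in W4I]%SET.

Definition WI_vars (W4I : {set W4}) : {set var} :=
  ([set in1 i | i : W1] :|: [set in2 i | i : W2] :|: W4I_vars W4I)%SET.

(* Vectors indexed by a finite type W are columns of height #|W|, the entry of
   index i : W being in row enum_rank i. *)
Definition point (R : realType) : lmodType R :=
  ('cV[R]_#|W1| * 'cV[R]_#|W2| * 'cV[R]_#|W3| * 'cV[R]_#|W4|)%type.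

Definition coord (R : realType) (v : point R) (j : var) : R :=
  let: (x, y, z, w) := v in
  match j with
  | inl (inl (inl i)) => x (enum_rank i) 0
  | inl (inl (inr i)) => y (enum_rank i) 0
  | inl (inr i) => z (enum_rank i) 0
  | inr i => w (enum_rank i) 0
  end.

Definition int_points (R : realType) (S : {set var}) : set (point R) :=
  [set v | forall j, j \in S -> coord v j \is a Num.int].

(* Infinite entries count as integral. *)
Definition int_bounds (S : {set var}) (l : var -> \bar rat) : Prop :=
  forall j (r : rat), j \in S -> l j = r%:E -> r \is a Num.int.

Section Polyhedron.
Variables (R : realType) (m1 m2 : nat).
Variables (A : 'M[int]_(m1, #|W1|)) (B : 'M[int]_(m1, #|W2|)).
Variables (C : 'M[int]_(m1, #|W3|)) (b : 'cV[int]_m1).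
Variables (D : 'M[rat]_(m2, #|W1|)) (E : 'M[rat]_(m2, #|W2|)).
Variables (F : 'M[rat]_(m2, #|W4|)) (g : 'cV[rat]_m2).
Variables (l u : var -> \bar rat).

Definition polyhedron : set (point R) :=
  [set v | let: (x, y, z, w) := v in
    [/\ map_mx intr A *m x + map_mx intr B *m y + map_mx intr C *m z
          = map_mx intr b,
        map_mx ratr D *m x + map_mx ratr E *m y + map_mx ratr F *m w
          = map_mx ratr g
      & forall j, (er_map ratr (l j) <= (coord v j)%:E <= er_map ratr (u j))%E]].

End Polyhedron.

Definition affine_fiber (R : realType) (P : set (point R)) (k : nat)
    (T : 'M[int]_(k, #|W2|)) (W4I : {set W4})
    (dW1 : 'cV[int]_#|W1|) (dT : 'cV[int]_k) (dW4I : {i | i \in W4I} -> int) :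
    set (point R) :=
  [set v | P v /\
    let: (x, y, z, w) := v in
    [/\ x = map_mx intr dW1,
        map_mx intr T *m y = map_mx intr dT
      & forall i : {i | i \in W4I}, w (enum_rank (val i)) 0 = (dW4I i)%:~R]].

(* The points of P with x, T y and the W4I-part of w integral (y itself need
   not be integral). *)
Definition int_fiber_points (R : realType) (P : set (point R)) (k : nat)
    (T : 'M[int]_(k, #|W2|)) (W4I : {set W4}) : set (point R) :=
  [set v | P v /\
    let: (x, y, z, w) := v in
    [/\ x \is a mxOver Num.int,
        map_mx intr T *m y \is a mxOver Num.int
      & int_points (W4I_vars W4I) v]].

End Variables.

Arguments int_points {W1 W2 W3 W4} R S _.
Arguments polyhedron {W1 W2 W3 W4} R {m1 m2} A B C b D E F g l u _.

(* Main.v *)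
Require Import Defs.
From mathcomp Require Import interval_inference lra.

(** On a fiber, [B y = S y + U dT] and [E y = Q dT], so the fiber is a product
    of [{x = dW1}], a set of [w]'s, and the set of [(y, z)] within their bounds
    that solve a system with the totally unimodular matrix [[S, C; T, 0]] and
    integral right-hand side. A solution [v] of such a system is a convex
    combination of integral solutions lying in the box between the floor and
    the ceiling of [v], hence satisfying every integral bound that [v] does.
    Indeed, the columns indexed by the fractional entries of [v] are linearly
    dependent, since otherwise Cramer's rule on a unimodular submatrix would
    make these entries integral; moving [v] both ways along a kernel vector
    until an entry reaches a wall of the box writes [v] as a convex combination
    of two points with fewer fractional entries. *)

Set Implicit Arguments.
Unset Strict Implicit.
Unset Printing Implicit Defensive.

Import Order.TTheory GRing.Theory Num.Theory.

Local Open Scope classical_set_scope.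
Local Open Scope ring_scope.

(** * Convex sets and hulls *)

Section ConvexSets.
Variables (R : realType) (V : lmodType R).
Implicit Types X K : set V.

Lemma convex_setP K :
  @convex_set R V K <->
  forall x y t, K x -> K y -> 0 <= t <= 1 -> K (t *: x + (1 - t) *: y).
Proof.
split=> [cK x y t Kx Ky t01|cK x y t /set_mem Kx /set_mem Ky].
  have := cK x y (Itv01 (proj1 (andP t01)) (proj2 (andP t01))).
  by move=> /(_ (mem_set Kx) (mem_set Ky)) /set_mem.
by apply/mem_set; apply: cK => //; rewrite ge0 le1.
Qed.

Lemma convex_hull_convex X : @convex_set R V (convex_hull X).
Proof.
apply/convex_setP => x y t Xx Xy t01 K [cK XK].
move/convex_setP: (cK); apply => //; first exact: Xx.
exact: Xy.
Qed.

Lemma convex_hull_sub X K :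
  @convex_set R V K -> X `<=` K -> convex_hull X `<=` K.
Proof. exact: smallest_sub. Qed.

Lemma sub_convex_hull X : X `<=` convex_hull X.
Proof. exact: sub_gen_smallest. Qed.

Lemma convex_hull_le X Y : X `<=` Y -> convex_hull X `<=` convex_hull Y.
Proof.
by move=> XY; apply: convex_hull_sub; [exact: convex_hull_convex|
   exact: subset_trans XY (@sub_convex_hull _)].
Qed.

End ConvexSets.

(** * Rounding solutions of totally unimodular systems *)

Section Rounding.
Variable R : realType.

Definition fractional n (v : 'cV[R]_n) : {set 'I_n} :=
  [set j | v j 0 \isn't a Num.int].

(** An integral entry of [v] is pinned, its floor and ceiling being equal; only fractional entries
    have room to move. *)
Definition in_rounding_box n (v w : 'cV[R]_n) :=
  forall j, (Num.floor (v j 0))%:~R <= w j 0 <= (Num.ceil (v j 0))%:~R.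

Lemma in_rounding_box_trans n (v w s : 'cV[R]_n) :
  in_rounding_box v w -> in_rounding_box w s -> in_rounding_box v s.
Proof.
move=> vw ws j; have /andP[lw wu] := vw j; have /andP[ls su] := ws j.
rewrite (le_trans _ ls) ?(le_trans su) // ler_int.
  by rewrite ceil_le_int.
by rewrite floor_ge_int.
Qed.

(** Every moving entry starts strictly between its walls, so the first collision takes positive
    time. The colliding entry becomes integral, while integral entries do not move and stay
    integral. *)
Lemma move_to_wall n (v h : 'cV[R]_n) :
    h != 0 -> (forall j, h j 0 != 0 -> j \in fractional v) ->
  exists t, [/\ 0 < t, in_rounding_box v (v + t *: h) &
    (#|fractional (v + t *: h)| < #|fractional v|)%N].
Proof.
move=> h_neq0 h_frac.
have [j0 hj0] : exists j, h j 0 != 0.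
  by have /cV0Pn[j] := h_neq0; exists j.
(* [wall j] is the integer that entry [j] heads for along [h], and [time j] is when it gets
   there. *)
pose wall j : R := if 0 < h j 0 then (Num.ceil (v j 0))%:~R
                   else (Num.floor (v j 0))%:~R.
pose time j := (wall j - v j 0) / h j 0.
have fracP j : h j 0 != 0 ->
    (Num.floor (v j 0))%:~R < v j 0 < (Num.ceil (v j 0))%:~R.
  move=> /h_frac; rewrite inE => vj.
  rewrite !lt_neqAle floor_le ceil_ge !andbT.
  by rewrite -intrEfloor vj eq_sym -intrEceil vj.
have time_gt0 j : h j 0 != 0 -> 0 < time j.
  move=> hj; have /andP[lv vu] := fracP j hj.
  rewrite /time /wall; case: (ltrP 0 (h j 0)) => hj0'.
    by rewrite divr_gt0 // subr_gt0.
  by rewrite nmulr_lgt0 ?invr_lt0 ?subr_lt0 // lt_neqAle hj.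
(* [i] is the first entry to collide; stopping at that moment keeps all the others within their
   walls. *)
case: (@arg_minP _ _ _ j0 (fun j => h j 0 != 0) time hj0) => i hi time_min.
have box : in_rounding_box v (v + time i *: h).
  move=> j; rewrite !mxE.
  have [->|hj] := eqVneq (h j 0) 0; first by rewrite mulr0 addr0 floor_le ceil_ge.
  have ti := time_gt0 i hi; have := time_min j hj.
  have /andP[lv vu] := fracP j hj.
  rewrite {2}/time /wall; case: (ltrP 0 (h j 0)) => hj0'.
    rewrite ler_pdivlMr // => le_wall; apply/andP; split; last by lra.
    by have : 0 < time i * h j 0 by [exact: mulr_gt0]; lra.
  have hj_lt0 : h j 0 < 0 by rewrite lt_neqAle hj.
  rewrite ler_ndivlMr // => le_wall; apply/andP; split; first by lra.
  by have : time i * h j 0 < 0 by [rewrite pmulr_rlt0]; lra.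
exists (time i); split => //; first exact: time_gt0.
apply: proper_card; apply/properP; split.
  apply/fintype.subsetP => j; rewrite !inE !mxE; apply: contra => vj.
  suff -> : h j 0 = 0 by rewrite mulr0 addr0.
  by apply/eqP; apply: contraTT vj => /h_frac; rewrite inE.
exists i; first exact: h_frac.
rewrite !inE !mxE negbK /time divfK // addrC subrK /wall.
by case: ifP => _; exact: intr_int.
Qed.

(** Since [\det G] squares to 1, the inverse of [G] is [\det G *: \adj G], an integer matrix. *)
Lemma unimodular_int_solution p (G : 'M[int]_p) (s : 'cV[R]_p) :
    \det G = 1 \/ \det G = -1 ->
    map_mx intr G *m s \is a mxOver Num.int -> s \is a mxOver Num.int.
Proof.
move=> detG Gs_int.
have detG2 : \det G * \det G = 1 by case: detG => ->.
have -> : s = map_mx intr (\det G *: \adj G) *m (map_mx intr G *m s).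
  rewrite mulmxA -map_mxM -scalemxAl mul_adj_mx scale_scalar_mx detG2 map_mx1.
  by rewrite mul1mx.
apply: mxOverM Gs_int; apply/mxOverP => i j; rewrite mxE; exact: intr_int.
Qed.

Lemma tu_fractional_kernel m n (M : 'M[int]_(m, n)) (v : 'cV[R]_n) :
    totally_unimodular M ->
    map_mx intr M *m v \is a mxOver Num.int -> fractional v != finset.set0 ->
  exists h : 'cV[R]_n, [/\ h != 0, map_mx intr M *m h = 0 &
    forall j, h j 0 != 0 -> j \in fractional v].
Proof.
move=> TU Mv_int /finset.set0Pn[j0 j0_frac].
set N := fractional v in j0_frac *.
pose col_of := @enum_val _ (mem N).
pose MR : 'M[R]_(m, n) := map_mx intr M.
(* [extend] pads a vector indexed by the fractional entries with zeros, so [M] acts on it through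
   the columns in [N] alone. *)
pose extend (s : 'cV[R]_#|N|) : 'cV[R]_n := colsub col_of 1%:M *m s.
have extendE s i : extend s (col_of i) 0 = s i 0.
  rewrite mxE (bigD1 i) //= !mxE eqxx mul1r big1 ?addr0 // => k ki.
  by rewrite !mxE (inj_eq enum_val_inj) eq_sym (negPf ki) mul0r.
have extend0 s j : j \notin N -> extend s j 0 = 0.
  move=> jN; rewrite mxE big1 // => k _; rewrite !mxE; case: eqP => [jk|_].
    by move: jN; rewrite jk enum_valP.
  by rewrite mul0r.
have M_extend s : MR *m extend s = colsub col_of MR *m s.
  by rewrite -{2}[MR]mulmx1 mxsub_mul mxsub_id -mulmxA.
(* [row_full] says that the rank equals the number of columns, so the columns in [N] are
   independent. Otherwise [cokermx] has a nonzero column, which pads to the required kernel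
   vector. *)
have [full|] := boolP (row_full (colsub col_of MR)); last first.
  rewrite -cokermx_eq0 => /matrix0Pn[i [j ker_ij]].
  exists (extend (col j (cokermx (colsub col_of MR)))); split.
  - by apply/cV0Pn; exists (col_of i); rewrite extendE mxE.
  - by rewrite M_extend colE mulmxA mulmx_coker mul0mx.
  - by move=> k; apply: contraNT => /extend0 ->.
(* In the independent case, [f] selects rows that form an invertible square submatrix; total
   unimodularity makes its determinant 1 or -1, and a contradiction follows. *)
pose f := fullrankfun full.
have := fullrowsub_unit full.
have -> : rowsub f (colsub col_of MR) = map_mx intr (mxsub f col_of M).
  by apply/matrixP => i j; rewrite !mxE.
rewrite unitmxE det_map_mx unitfE intr_eq0 => det_neq0.
have detG := TU _ _ _ (@fullrankfun_inj _ _ _ _ full)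
  (@enum_val_inj _ (mem N)) det_neq0.
pose vN := rowsub col_of v.
have vNE j : j \in N -> extend vN j 0 = v j 0.
  by move=> jN; rewrite -(enum_rankK_in jN jN) extendE mxE.
(* Removing the fractional entries leaves an integral vector, so the columns in [N] applied to [vN]
   still give an integral result. *)
have vNc_int : v - extend vN \is a mxOver Num.int.
  apply/mxOverP => j k; rewrite ord1.
  have -> : (v - extend vN) j 0 = v j 0 - extend vN j 0.
    by rewrite mxE [X in _ + X]mxE.
  have [/vNE ->|jN] := boolP (j \in N); first by rewrite subrr.
  by rewrite extend0 // subr0; move: jN; rewrite inE negbK.
have vN_int : vN \is a mxOver Num.int.
  apply: (unimodular_int_solution detG).
  have -> : map_mx intr (mxsub f col_of M) *m vN
      = rowsub f (MR *m v - MR *m (v - extend vN)).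
    rewrite -mulmxBr subKr M_extend mxsub_mul; congr (_ *m _).
      by apply/matrixP => i j; rewrite !mxE.
    by apply/matrixP => i j; rewrite !mxE.
  have MR_int : MR \is a mxOver Num.int.
    by apply/mxOverP => i j; rewrite mxE; exact: intr_int.
  have /mxOverP MvN_int := mxOverM MR_int vNc_int.
  apply/mxOverP => i j; rewrite mxE mxE [X in _ + X]mxE.
  by rewrite rpredB // (mxOverP Mv_int).
have := j0_frac; rewrite inE -vNE // -(enum_rankK_in j0_frac j0_frac) extendE.
by rewrite (mxOverP vN_int).
Qed.

(** Quantifying over convex sets [K] expresses membership in the hull of the integral solutions in
    the box without naming any weights. The induction is on the number of fractional entries; the
    box of a moved point lies inside the original box, so the hypothesis on [K] carries over. *)
Lemma tu_rounding m n (M : 'M[int]_(m, n)) (K : set 'cV[R]_n) (v : 'cV[R]_n) :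
    totally_unimodular M -> @convex_set R 'cV[R]_n K ->
    map_mx intr M *m v \is a mxOver Num.int ->
    (forall w : 'cV[R]_n, w \is a mxOver Num.int ->
       map_mx intr M *m w = map_mx intr M *m v -> in_rounding_box v w -> K w) ->
  K v.
Proof.
move=> TU /convex_setP cK.
have [c] := ubnP #|fractional v|; elim: c v => // c IH v le_c Mv_int K_round.
have [frac0|frac_neq0] := eqVneq (fractional v) finset.set0.
  apply: K_round => //.
    apply/mxOverP => i j; rewrite ord1; apply: contraT => vi.
    by have := finset.in_set0 i; rewrite -frac0 inE vi.
  by move=> j; rewrite floor_le ceil_ge.
have [h [h_neq0 Mh h_frac]] := tu_fractional_kernel TU Mv_int frac_neq0.
have K_move g : g != 0 -> map_mx intr M *m g = 0 ->
    (forall j, g j 0 != 0 -> j \in fractional v) ->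
    exists2 t, 0 < t & K (v + t *: g).
  move=> g_neq0 Mg g_frac.
  have [t [t_gt0 box lt_frac]] := move_to_wall g_neq0 g_frac.
  have Mt : map_mx intr M *m (v + t *: g) = map_mx intr M *m v.
    by rewrite mulmxDr -scalemxAr Mg scaler0 addr0.
  exists t => //; apply: IH; rewrite ?Mt //; first exact: leq_trans lt_frac _.
  by move=> w w_int Mw /(in_rounding_box_trans box); exact: K_round.
have [s s_gt0 Ks] := K_move h h_neq0 Mh h_frac.
have [||j|t t_gt0 Kt] := K_move (- h).
- by rewrite oppr_eq0.
- by rewrite mulmxN Mh oppr0.
- by rewrite mxE oppr_eq0; exact: h_frac.
have st_gt0 : 0 < s + t by exact: addr_gt0.
(* The weights [t / (s + t)] and [s / (s + t)] cancel the displacements [s *: h] and [- t *: h]. *)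
have -> : v = (t / (s + t)) *: (v + s *: h) + (1 - t / (s + t)) *: (v + t *: - h).
  rewrite -[1](@divff _ (s + t)) ?gt_eqF // -mulrBl addrK.
  rewrite !scalerDr addrACA -scalerDl -mulrDl [t + s]addrC divff ?gt_eqF //.
  rewrite scale1r !scalerN !scalerA [s / _ * t]mulrAC [t / _ * s]mulrAC.
  by rewrite [s * t]mulrC subrr addr0.
apply: cK => //; apply/andP; split; first by rewrite divr_ge0 ?ltW.
by rewrite ler_pdivrMr // mul1r lerDr ltW.
Qed.
End Rounding.

(** * Variable bounds under convex combination and rounding *)

Section Bounds.
Variable R : realType.
Implicit Types x y w t : R.

Lemma lower_bound_conv (a : \bar R) x y t : 0 <= t <= 1 ->
  (a <= x%:E -> a <= y%:E -> a <= (t * x + (1 - t) * y)%:E)%E.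
Proof.
move=> /andP[t0 t1]; case: a => [r| |]; rewrite ?lee_fin ?leNye //=.
by move=> rx ry; nra.
Qed.

Lemma upper_bound_conv (a : \bar R) x y t : 0 <= t <= 1 ->
  (x%:E <= a -> y%:E <= a -> (t * x + (1 - t) * y)%:E <= a)%E.
Proof.
move=> /andP[t0 t1]; case: a => [r| |]; rewrite ?lee_fin ?leey //=.
by move=> rx ry; nra.
Qed.

(** An integer below [x] is also below the floor of [x]: this is how integrality of the bounds lets
    them survive rounding. *)
Lemma lower_bound_floor (a : \bar rat) x w :
    (forall r, a = r%:E -> r \is a Num.int) ->
    (er_map ratr a <= x%:E)%E -> (Num.floor x)%:~R <= w ->
  (er_map ratr a <= w%:E)%E.
Proof.
case: a => [r /(_ r erefl)/intrP[i ->]| |] //=; rewrite ?leNye //.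
rewrite ratr_int !lee_fin => ix; apply: le_trans.
by rewrite ler_int floor_ge_int.
Qed.

Lemma upper_bound_ceil (a : \bar rat) x w :
    (forall r, a = r%:E -> r \is a Num.int) ->
    (x%:E <= er_map ratr a)%E -> w <= (Num.ceil x)%:~R ->
  (w%:E <= er_map ratr a)%E.
Proof.
case: a => [r /(_ r erefl)/intrP[i ->]| |] //=; rewrite ?leey //.
rewrite ratr_int !lee_fin => xi /le_trans; apply.
by rewrite ler_int ceil_le_int.
Qed.

End Bounds.

Lemma int_mxP (R : realType) m n (M : 'M[R]_(m, n)) :
  M \is a mxOver Num.int -> exists N : 'M[int]_(m, n), M = map_mx intr N.
Proof.
move=> /mxOverP M_int; exists (map_mx Num.floor M).
by apply/matrixP => i j; rewrite !mxE floorK.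
Qed.

Lemma intr_mx_int (R : realType) m n (N : 'M[int]_(m, n)) :
  map_mx intr N \is a @mxOver m n R Num.int.
Proof. by apply/mxOverP => i j; rewrite mxE; exact: intr_int. Qed.

(** * Affine fibers as hulls of their integral points *)

Section Fibers.
Variables (R : realType) (W1 W2 W3 W4 : finType) (W4I : {set W4}).
Variables (m1 m2 : nat).
Variables (A : 'M[int]_(m1, #|W1|)) (B : 'M[int]_(m1, #|W2|)).
Variables (C : 'M[int]_(m1, #|W3|)) (b : 'cV[int]_m1).
Variables (D : 'M[rat]_(m2, #|W1|)) (E : 'M[rat]_(m2, #|W2|)).
Variables (F : 'M[rat]_(m2, #|W4|)) (g : 'cV[rat]_m2).
Variables (l u : var W1 W2 W3 W4 -> \bar rat).
Variables (k : nat) (T : 'M[int]_(k, #|W2|)).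

Let P := polyhedron R A B C b D E F g l u.
Let WI := WI_vars W1 W2 W3 W4I.
Let WI3 := (WI :|: W3_vars W1 W2 W3 W4)%SET.

Lemma coord_conv (v w : point W1 W2 W3 W4 R) (s t : R) j :
  coord (s *: v + t *: w) j = s * coord v j + t * coord w j.
Proof.
case: v w => [[[x y] z] w] [[[x' y'] z'] w'].
by case: j => [[[]|]|] i /=; rewrite !mxE.
Qed.

Lemma affine_fiber_convex dW1 dT (dW4I : {i | i \in W4I} -> int) :
  @convex_set R (point W1 W2 W3 W4 R) (affine_fiber P T dW1 dT dW4I).
Proof.
apply/convex_setP => v v' t + + t01.
have conv_eq m n (M : 'M[R]_(m, n)) a a' :
    M *m (t *: a + (1 - t) *: a') = t *: (M *m a) + (1 - t) *: (M *m a') :> 'cV_m.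
  by rewrite mulmxDr -!scalemxAr.
have conv_id n (a : 'cV[R]_n) : t *: a + (1 - t) *: a = a.
  by rewrite -scalerDl addrCA subrr addr0 scale1r.
have conv_add n (a1 a2 a3 a1' a2' a3' : 'cV[R]_n) :
    t *: a1 + (1 - t) *: a1' + (t *: a2 + (1 - t) *: a2')
      + (t *: a3 + (1 - t) *: a3')
    = t *: (a1 + a2 + a3) + (1 - t) *: (a1' + a2' + a3').
  by rewrite !scalerDr [RHS]addrACA; congr (_ + _); exact: addrACA.
case: v v' => [[[x y] z] w] [[[x' y'] z'] w'].
move=> [[eq1 eq2 bnd] [ex ey ew]] [[eq1' eq2' bnd'] [ex' ey' ew']].
split; [split|split].
- by rewrite !conv_eq conv_add eq1 eq1' conv_id.
- by rewrite !conv_eq conv_add eq2 eq2' conv_id.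
- move=> j; have /andP[lj ju] := bnd j; have /andP[lj' ju'] := bnd' j.
  rewrite -[X in coord X]/(t *: (x, y, z, w) + (1 - t) *: (x', y', z', w')).
  by rewrite coord_conv lower_bound_conv // upper_bound_conv.
- by rewrite ex ex' conv_id.
- by rewrite conv_eq ey ey' conv_id.
- by move=> i; rewrite !mxE ew ew' -mulrDl addrCA subrr addr0 mul1r.
Qed.

Variables (S : 'M[int]_(m1, #|W2|)) (U : 'M[int]_(m1, k)).
Variables (Q : 'M[rat]_(m2, k)).
Hypothesis B_eq : B = S + U *m T.
Hypothesis E_eq : E = Q *m map_mx intr T.
Hypothesis TU : totally_unimodular (block_mx S C T 0).
Hypothesis l_int : int_bounds WI3 l.
Hypothesis u_int : int_bounds WI3 u.

Lemma in2_WI3 i : in2 W1 W3 W4 i \in WI3.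
Proof. by rewrite !inE imset_f ?orbT. Qed.

Lemma in3_WI3 i : in3 W1 W2 W4 i \in WI3.
Proof. by rewrite !inE imset_f ?orbT. Qed.

Lemma in4_WI3 i : (in4 W1 W2 W3 i \in WI3) = (i \in W4I).
Proof.
have in4_inj : injective (@in4 W1 W2 W3 W4) by move=> ? ? [].
rewrite !inE (mem_imset _ _ in4_inj).
by case: (i \in W4I); rewrite ?orbT // !orbF; apply/negbTE/norP; split;
  first apply/norP; try split; apply/imsetP => -[].
Qed.

(** Only [(y, z)] gets rounded: [x] and the [W4I] part of [w] are already integral on the fiber, and
    the rest of [w] is unconstrained by [WI3]. *)
Lemma affine_fiber_sub_hull dW1 dT (dW4I : {i | i \in W4I} -> int) :
  let H := affine_fiber P T dW1 dT dW4I in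
  H `<=` convex_hull (H `&` int_points R WI3).
Proof.
move=> H [[[x y] z] w] [[eq1 eq2 bnd] [ex ey ew]] K [cK HK].
(* [K'] is the slice of [K] at the given [x] and [w], with [y] and [z] stacked into one column to
   match the totally unimodular matrix. *)
pose K' : set 'cV[R]_(#|W2| + #|W3|) :=
  [set s | K (x, usubmx s, dsubmx s, w)].
pose M : 'M[R]_(m1 + k, #|W2| + #|W3|) := map_mx intr (block_mx S C T 0).
have ME s : M *m s = col_mx
    (map_mx intr S *m usubmx s + map_mx intr C *m dsubmx s)
    (map_mx intr T *m usubmx s).
  rewrite -{1}[s]vsubmxK /M map_block_mx mul_block_col map_mx0 mul0mx.
  by rewrite addr0.
have BE s : map_mx intr B *m s = map_mx intr S *m s
    + map_mx intr U *m (map_mx intr T *m s) :> 'cV[R]_m1.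
  by rewrite B_eq map_mxD map_mxM mulmxDl mulmxA.
have EE s : map_mx ratr E *m s
    = map_mx ratr Q *m (map_mx intr T *m s) :> 'cV[R]_m2.
  have -> : map_mx intr T
      = map_mx ratr (map_mx intr T : 'M[rat]_(_, _)) :> 'M[R]_(_, _).
    by apply/matrixP => i j; rewrite !mxE ratr_int.
  by rewrite E_eq map_mxM mulmxA.
suff : K' (col_mx y z) by rewrite /K' /= col_mxKu col_mxKd.
apply: (tu_rounding TU).
- apply/convex_setP => s s' t Ks Ks' t01.
  move/convex_setP: cK => /(_ _ _ _ Ks Ks' t01).
  have -> // : K' (t *: s + (1 - t) *: s') = K (t *: (x, usubmx s, dsubmx s, w)
      + (1 - t) *: (x, usubmx s', dsubmx s', w)).
  rewrite -[RHS]/(K (t *: x + (1 - t) *: x,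
    t *: usubmx s + (1 - t) *: usubmx s', t *: dsubmx s + (1 - t) *: dsubmx s',
    t *: w + (1 - t) *: w)).
  by rewrite -!scalerDl addrCA subrr addr0 !scale1r /K' /= !linearD !linearZ.
- rewrite -/M ME col_mxKu col_mxKd.
  (* With [x] and [T y] fixed on the fiber, the first block of equations has the integral right-hand
     side [b - A dW1 - U dT]. *)
  have -> : map_mx intr S *m y + map_mx intr C *m z
      = map_mx intr (b - A *m dW1 - U *m dT).
    rewrite !map_mxB !map_mxM -eq1 BE ey ex; apply/eqP.
    by rewrite eq_sym !subr_eq -addrA addrC [X in X + _ == _]addrAC.
  by rewrite ey -map_col_mx intr_mx_int.
move=> s s_int; rewrite -/M !ME col_mxKu col_mxKd => /eq_col_mx[Ms Ts] box.
have y_box i : (Num.floor (y i 0))%:~R <= usubmx s i 0 <= (Num.ceil (y i 0))%:~R.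
  by have := box (lshift _ i); rewrite col_mxEu [usubmx _ _ _]mxE.
have z_box i : (Num.floor (z i 0))%:~R <= dsubmx s i 0 <= (Num.ceil (z i 0))%:~R.
  by have := box (rshift _ i); rewrite col_mxEd [dsubmx _ _ _]mxE.
(* The rounded point stays in the fiber: [B] and [E] factor through [S] and [T], so equal [T y] and
   equal [S y + C z] preserve both systems of equations. *)
apply: HK; split; [split; [split|split]|] => //.
- by rewrite -eq1 !BE Ts -!addrA; congr (_ + _); rewrite addrCA Ms addrCA.
- by rewrite EE Ts -EE.
- move=> j; have := bnd j; case: j => [[[i|i]|i]|i] //=.
  + move=> /andP[lj uj]; have /andP[fl ce] := y_box (enum_rank i).
    apply/andP; split.
      by apply: lower_bound_floor lj fl => r; apply: l_int; exact: in2_WI3.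
    by apply: upper_bound_ceil uj ce => r; apply: u_int; exact: in2_WI3.
  + move=> /andP[lj uj]; have /andP[fl ce] := z_box (enum_rank i).
    apply/andP; split.
      by apply: lower_bound_floor lj fl => r; apply: l_int; exact: in3_WI3.
    by apply: upper_bound_ceil uj ce => r; apply: u_int; exact: in3_WI3.
- by rewrite Ts.
move=> [[[i|i]|i]|i] jS /=.
- by rewrite ex mxE; exact: intr_int.
- by rewrite mxE (mxOverP s_int).
- by rewrite mxE (mxOverP s_int).
rewrite in4_WI3 in jS.
by rewrite (ew (exist _ i jS)); exact: intr_int.
Qed.

End Fibers.

(** * From the fibers to the whole polyhedron *)

Theorem theorem33 (R : realType) (W1 W2 W3 W4 : finType) (W4I : {set W4})
    (m1 m2 : nat)
    (A : 'M[int]_(m1, #|W1|)) (B : 'M[int]_(m1, #|W2|))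
    (C : 'M[int]_(m1, #|W3|)) (b : 'cV[int]_m1)
    (D : 'M[rat]_(m2, #|W1|)) (E : 'M[rat]_(m2, #|W2|))
    (F : 'M[rat]_(m2, #|W4|)) (g : 'cV[rat]_m2)
    (l u : var W1 W2 W3 W4 -> \bar rat)
    (l_lt_pinfty : forall j, l j != +oo%E)
    (u_gt_ninfty : forall j, u j != -oo%E)
    (l_le_u : forall j, (l j <= u j)%E)
    (k : nat) (k_le_W2 : (k <= #|W2|)%N)
    (S : 'M[int]_(m1, #|W2|)) (U : 'M[int]_(m1, k))
    (T : 'M[int]_(k, #|W2|)) (Q : 'M[rat]_(m2, k))
    (B_eq : B = S + U *m T)
    (E_eq : E = Q *m map_mx intr T)
    (TU : totally_unimodular (block_mx S C T 0))
    (l_int : int_bounds (WI_vars W1 W2 W3 W4I :|: W3_vars W1 W2 W3 W4)%SET l)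
    (u_int : int_bounds (WI_vars W1 W2 W3 W4I :|: W3_vars W1 W2 W3 W4)%SET u) :
  let P := polyhedron R A B C b D E F g l u in
  let M_WI := int_points R (WI_vars W1 W2 W3 W4I) in
  let M_WI_W3 :=
    int_points R (WI_vars W1 W2 W3 W4I :|: W3_vars W1 W2 W3 W4)%SET in
  (forall (dW1 : 'cV[int]_#|W1|) (dT : 'cV[int]_k)
          (dW4I : {i | i \in W4I} -> int),
     let H := affine_fiber P T dW1 dT dW4I in
     H = convex_hull (H `&` M_WI) /\
     convex_hull (H `&` M_WI) = convex_hull (H `&` M_WI_W3)) /\
  (convex_hull (P `&` M_WI) = convex_hull (P `&` M_WI_W3) /\
   convex_hull (P `&` M_WI_W3) = convex_hull (int_fiber_points P T W4I)).
Proof.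
move=> P M_WI M_WI_W3.
have MW : M_WI_W3 `<=` M_WI.
  by move=> v v_int j jS; apply: v_int; rewrite inE jS.
have sub_hull dW1 dT (dW4I : {i | i \in W4I} -> int) :=
  @affine_fiber_sub_hull R _ _ _ _ W4I m1 m2 A B C b D E F g l u k T S U Q
    B_eq E_eq TU l_int u_int dW1 dT dW4I.
have hull_sub dW1 dT (dW4I : {i | i \in W4I} -> int) X :
    convex_hull (affine_fiber P T dW1 dT dW4I `&` X)
    `<=` affine_fiber P T dW1 dT dW4I.
  by apply: convex_hull_sub; [exact: affine_fiber_convex|move=> v []].
have int_sub : P `&` M_WI `<=` int_fiber_points P T W4I.
  move=> [[[x y] z] w] [Pv v_int]; split => //; split.
  - by apply/mxOverP => i j; rewrite ord1 -(enum_valK i);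
       apply: (v_int (in1 _ _ _ _)); rewrite !inE imset_f ?orbT.
  - apply: mxOverM; first exact: intr_mx_int.
    by apply/mxOverP => i j; rewrite ord1 -(enum_valK i);
       apply: (v_int (in2 _ _ _ _)); rewrite !inE imset_f ?orbT.
  - by move=> j jS; apply: v_int; rewrite !inE jS orbT.
have fiber_sub : int_fiber_points P T W4I `<=` convex_hull (P `&` M_WI_W3).
  move=> [[[x y] z] w] [Pv [/int_mxP[dx ex] /int_mxP[dT eT] w_int]].
  (* The point's own integral data define a fiber through it; the floors in [dw] are exact because
     those entries of [w] are integers. *)
  pose dw (i : {i | i \in W4I}) := Num.floor (w (enum_rank (val i)) 0).
  have : affine_fiber P T dx dT dw (x, y, z, w).
    split => //; split => // -[i iI]; rewrite /dw /= floorK //.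
    by apply: (w_int (in4 _ _ _ i)); rewrite imset_f.
  move/sub_hull; apply: convex_hull_le => v [[Pv' _] v_int]; split => //.
(* For a fiber, the inclusions close up: [H] lies in the smaller hull, which lies in the larger one,
   which lies in [H] by convexity. *)
split=> [dW1 dT dW4I H|].
  have HW : convex_hull (H `&` M_WI_W3) `<=` convex_hull (H `&` M_WI).
    by apply: convex_hull_le; exact: setIS.
  split; apply/seteqP; split => //.
  - exact: subset_trans (@sub_hull _ _ _) HW.
  - exact: hull_sub.
  - exact: subset_trans (@hull_sub _ _ _ _) (@sub_hull _ _ _).
(* The three hulls of the second claim likewise contain one another cyclically. *)
have hull_fiber : convex_hull (int_fiber_points P T W4I)
    `<=` convex_hull (P `&` M_WI_W3).
  by apply: convex_hull_sub fiber_sub; exact: convex_hull_convex.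
have PW : convex_hull (P `&` M_WI_W3) `<=` convex_hull (P `&` M_WI).
  by apply: convex_hull_le; exact: setIS.
have WF : convex_hull (P `&` M_WI) `<=` convex_hull (int_fiber_points P T W4I).
  exact: convex_hull_le.
split; apply/seteqP; split => //.
- exact: subset_trans WF hull_fiber.
- exact: subset_trans PW WF.
Qed.
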